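(* Let $\alpha:[0,\infty)\to\mathbb{R}^d\otimes\mathbb{R}^d$ be a continuous and bounded function with values in the $d\times d$ matrices, and let $\beta:[0,\infty)\to\mathbb{R}$ be a continuous function with $\beta(0)\neq 0$. Assume that $$\lambda(\{t\ge 0:\ \beta(t)=0\})=0,$$ where $\lambda$ is Lebesgue measure. Let $\gamma:[0,\infty)\to\mathbb{R}^d\otimes\mathbb{R}^d$ be the unique solution of the system $$P\gamma(t)=P+\int_0^t P\alpha(s)\gamma(s)\,ds,\quad t\ge 0,$$ $$Q\gamma(t)=\begin{cases} Q+\int_0^t Q\alpha(s)\gamma(s)\,ds, & t<\sigma_0,\\ \int_{\tau(t)}^t Q\alpha(s)\gamma(s)\,ds, & t\ge\sigma_0.\end{cases}$$ Then $$\gamma(t)=\begin{cases}\mathcal{E}_{0t}, & t<\sigma_0,\\ \mathcal{E}_{\tau(t)\,t}\,P\left(\prod_{(\sigma_i,\tau_i)\subset[0,t]}\bigl(P\mathcal{E}_{\sigma_i\tau_i}P\bigr)\right)\mathcal{E}_{0\sigma_0}, & t\ge\sigma_0.\end{cases}$$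
   Context: $E$ is the $d\times d$ identity matrix, $P=\mathrm{diag}(1,\dots,1,0)$ and $Q=E-P=\mathrm{diag}(0,\dots,0,1)$. $\sigma_0=\inf\{t\ge0:\beta(t)=0\}$ (with $\sigma_0=\infty$ if $\beta$ has no zeros) and $\tau(t)=\sup\{s\in[0,t]:\beta(s)=0\}$ for $t\ge\sigma_0$. It is known that, for every continuous bounded $\alpha$ and continuous $\beta$ with $\beta(0)\ne0$, the system in the claim has a unique solution $\gamma$. For $0\le s\le t$, $\mathcal{E}_{st}$ is the matrix-valued solution of $\frac{\partial\mathcal{E}_{st}}{\partial t}=\alpha(t)\mathcal{E}_{st}$ for $t\ge s$, with $\mathcal{E}_{ss}=E$. The set $\{t\ge0:\beta(t)\ne0\}$ is written as the at most countable union of disjoint sets $[0,\sigma_0)\cup\bigcup_k(\sigma_k,\tau_k)$, where the $(\sigma_k,\tau_k)$ are the connected components lying after $\sigma_0$ (possibly $\tau_k=\infty$ for some $k$). The intervals are linearly ordered by $(\sigma_i,\tau_i)<(\sigma_j,\tau_j)\Leftrightarrow\tau_i\le\sigma_j$ for distinct intervals, i.e. from left to right on the line. Ordered products: for a finite set of indices, $\prod$ denotes the matrix product with the factors of greater index placed on the left; an empty product is $E$. For a countable linearly ordered index set $K$, $\prod_{k\in K}A_k$ converges and equals $U$ if for every $\varepsilon>0$ there is a finite $L_0\subset K$ such that for every finite $L$ with $L_0\subset L\subset K$ one has $\|\prod_{k\in L}A_k-U\|<\varepsilon$ (operator norm). The product in the claim is over all intervals $(\sigma_i,\tau_i)$ contained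 in $[0,t]$ and is understood in this sense. *)

(* Defs.v *)
From HB Require Import structures.
From mathcomp Require Export all_boot all_order all_algebra finmap.
From mathcomp Require Export all_classical all_reals all_analysis.

Set Implicit Arguments.
Unset Strict Implicit.
Unset Printing Implicit Defensive.

Import Order.TTheory GRing.Theory Num.Theory.
Import numFieldNormedType.Exports.

Local Open Scope classical_set_scope.
Local Open Scope ring_scope.

(* Matrices are square of size d.+1, so the dimension ranges over the integers
   >= 1.  Functions on [0, +oo[ are functions on R of which only the values at
   nonnegative arguments are ever used. *)

Definition matP (R : realType) (d : nat) : 'M[R]_d.+1 :=
  diag_mx (\row_(i < d.+1) (i != ord_max)%:R).

Definition matQ (R : realType) (d : nat) : 'M[R]_d.+1 := 1%:M - matP R d.

Definition l2_norm (R : realType) (n : nat) (v : 'cV[R]_n) : R :=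
  Num.sqrt (\sum_(i < n) v i ord0 ^+ 2).

Definition op_norm (R : realType) (n : nat) (A : 'M[R]_n) : R :=
  sup [set l2_norm (A *m v) | v in [set v : 'cV[R]_n | l2_norm v <= 1]].

(* Entrywise Lebesgue integral over [a, b]. *)
Definition mx_integral (R : realType) (m n : nat) (a b : R)
    (F : R -> 'M[R]_(m, n)) : 'M[R]_(m, n) :=
  \matrix_(i, j) \int[@lebesgue_measure R]_(s in `[a, b]) F s i j.

Definition mx_integrable (R : realType) (m n : nat) (a b : R)
    (F : R -> 'M[R]_(m, n)) : Prop :=
  forall i j,
    (@lebesgue_measure R).-integrable `[a, b] (fun s => (F s i j)%:E).

Definition zeros (R : realType) (beta : R -> R) : set R :=
  [set t | 0 <= t /\ beta t = 0].

(* The infimum of the empty set is +oo. *)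
Definition sigma0 (R : realType) (beta : R -> R) : \bar R :=
  ereal_inf [set t%:E | t in zeros beta].

(* Only meaningful for sigma0 beta <= t, where the set is nonempty. *)
Definition tau (R : realType) (beta : R -> R) (t : R) : R :=
  sup [set s | s <= t /\ zeros beta s].

(* The integrability clause is what makes the integrals of the system
   meaningful; no other regularity is required of gamma. *)
Definition is_solution (R : realType) (d : nat)
    (alpha : R -> 'M[R]_d.+1) (beta : R -> R) (gamma : R -> 'M[R]_d.+1) : Prop :=
  forall t : R, 0 <= t ->
  [/\ mx_integrable 0 t (fun s => alpha s *m gamma s),
      matP R d *m gamma t =
        matP R d + mx_integral 0 t (fun s => matP R d *m alpha s *m gamma s)
    & matQ R d *m gamma t =
        if (t%:E < sigma0 beta)%E
        then matQ R d + mx_integral 0 t (fun s => matQ R d *m alpha s *m gamma s)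
        else mx_integral (tau beta t) t
               (fun s => matQ R d *m alpha s *m gamma s)].

(* Derivative at t relative to D: one-sided at the endpoints of an interval. *)
Definition has_derivative_within (R : realType) (m n : nat) (D : set R)
    (f : R -> 'M[R]_(m.+1, n.+1)) (t : R) (l : 'M[R]_(m.+1, n.+1)) : Prop :=
  ((u - t)^-1 *: (f u - f t)) @[u --> within D t^'] --> l.

Definition is_evolution (R : realType) (d : nat)
    (alpha : R -> 'M[R]_d.+1) (Ev : R -> R -> 'M[R]_d.+1) : Prop :=
  forall s : R, 0 <= s ->
    Ev s s = 1%:M /\
    forall t : R, s <= t ->
      has_derivative_within [set u | s <= u] (Ev s) t (alpha t *m Ev s t).

(* The pair (a, b) stands for the interval ]a, b[.  An unbounded component lies
   in no [0, t], so pairs of real endpoints suffice. *)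
Definition excursion (R : realType) (beta : R -> R) (p : R * R) : Prop :=
  let Z := [set t : R | 0 <= t /\ beta t != 0] in
  [/\ p.1 < p.2, (sigma0 beta <= p.1%:E)%E
    & exists2 x, Z x & connected_component Z x = [set` `]p.1, p.2[]].

Definition excursions_in (R : realType) (beta : R -> R) (t : R) : set (R * R) :=
  [set p | excursion beta p /\ `]p.1, p.2[ `<=` `[0, t]].

(* Reflexive closure of the strict order "p lies to the left of q"; it is total
   on the excursions only. *)
Definition itv_le (R : realType) : rel (R * R) :=
  fun p q => (p == q) || (p.2 <= q.1).

(* The factors are listed by decreasing index, the greatest one leftmost. *)
Definition fin_ordered_prod (R : realType) (d : nat) (I : choiceType)
    (le : rel I) (A : I -> 'M[R]_d.+1) (L : {fset I}) : 'M[R]_d.+1 :=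
  \prod_(k <- rev (sort le (enum_fset L))) A k.

Definition ordered_prod_cvg (R : realType) (d : nat) (I : choiceType)
    (le : rel I) (K : set I) (A : I -> 'M[R]_d.+1) (U : 'M[R]_d.+1) : Prop :=
  forall e : R, 0 < e ->
    exists2 L0 : {fset I}, [set` L0] `<=` K &
      forall L : {fset I}, [set` L0] `<=` [set` L] -> [set` L] `<=` K ->
        op_norm (fin_ordered_prod le A L - U) < e.

(* Main.v *)
Require Import Defs.
From mathcomp Require Import ring lra.

Set Implicit Arguments.
Unset Strict Implicit.
Unset Printing Implicit Defensive.

Import Order.TTheory GRing.Theory Num.Theory.
Import numFieldNormedType.Exports.

Local Open Scope classical_set_scope.
Local Open Scope ring_scope.

(** Between two consecutive zeros of beta the solution follows the linear flow: on
    an excursion (s, r), gamma u = Ev s u *m gamma s for s <= u < r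
    ([solution_flow]), and at a zero its last row vanishes, so that
    gamma s = P *m gamma s there ([solution_at_zero]).  The function
    x u = P *m gamma u is not reset at the zeros.  Hence it satisfies
    x r = (P *m Ev s r *m P) *m x s on every excursion ([solution_excursion]),
    and it is Lipschitz on bounded intervals, because alpha gamma is bounded there
    ([drift_bounded]).

    Let L be a finite family of excursions contained in [0, t].  A telescoping sum
    ([telescoping_bound]) bounds the difference between x (tau t) and the ordered
    product over L applied to x sigma0 by a constant times the length of
    [sigma0, tau t] not covered by L.  The constant does not depend on L: the
    energy estimate [sumsq_growth] bounds a product of factors P *m Ev s r *m P by
    the exponential of a multiple of the total length of the excursions.  The zeros
    form a closed null set, so by outer regularity and compactness finitely many
    excursions leave an arbitrarily small length uncovered
    ([finite_excursions_almost_cover]).  Thus the products applied to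
    x sigma0 = P *m Ev 0 sigma0 converge to x (tau t) ([finite_product_approx]).

    Finally Ev 0 sigma0 is invertible ([evolution_unitmx]), and a nonempty product
    absorbs P on its right.  So the products themselves converge, to
    U = x (tau t) *m (Ev 0 sigma0)^-1, and P *m U *m Ev 0 sigma0 = x (tau t) =
    gamma (tau t).  If there is no excursion, then U = 1 and
    x (tau t) = x sigma0. *)

(** * Sums of squares of matrix entries *)

(** The square of the Frobenius norm. *)
Definition sumsq (R : realType) m n (A : 'M[R]_(m, n)) : R :=
  \sum_i \sum_j A i j ^+ 2.

Section SumOfSquares.
Context {R : realType}.

Lemma sqr_le_of_norm_le (x c : R) : `|x| <= c -> x ^+ 2 <= c ^+ 2.
Proof.
move=> xc; rewrite -(real_normK (num_real x)).
by apply: lerXn2r; rewrite ?nnegrE// (le_trans _ xc).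
Qed.

Lemma sumsq_ge0 m n (A : 'M[R]_(m, n)) : 0 <= sumsq A.
Proof. by apply: sumr_ge0 => i _; apply: sumr_ge0 => j _; exact: sqr_ge0. Qed.

Lemma sqr_entry_le_sumsq m n (A : 'M[R]_(m, n)) i j : A i j ^+ 2 <= sumsq A.
Proof.
rewrite /sumsq (bigD1 i)//= (bigD1 j)//= -addrA lerDl addr_ge0//.
  by apply: sumr_ge0 => *; exact: sqr_ge0.
by apply: sumr_ge0 => *; apply: sumr_ge0 => *; exact: sqr_ge0.
Qed.

Lemma sumsq_le0 m n (A : 'M[R]_(m, n)) : sumsq A <= 0 -> A = 0.
Proof.
move=> A0; apply/matrixP => i j; rewrite mxE; apply/eqP.
by rewrite -sqrf_eq0 eq_le sqr_ge0 (le_trans (sqr_entry_le_sumsq _ _ _)).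
Qed.

Lemma sumsq0 m n : sumsq (0 : 'M[R]_(m, n)) = 0.
Proof.
by rewrite /sumsq big1// => i _; rewrite big1// => j _; rewrite mxE expr0n.
Qed.

Lemma sumsq_le m n (A : 'M[R]_(m, n)) c : (forall i j, `|A i j| <= c) ->
  sumsq A <= m%:R * n%:R * c ^+ 2.
Proof.
move=> Ac; rewrite /sumsq.
have -> : m%:R * n%:R * c ^+ 2 = \sum_(i < m) \sum_(j < n) c ^+ 2.
  by rewrite !sumr_const !card_ord -mulrA !mulr_natl.
apply: ler_sum => i _; apply: ler_sum => j _.
exact: sqr_le_of_norm_le.
Qed.

(** The sum on the left is half the derivative of [sumsq B] along B' = A B. *)
Lemma sumsq_mulmx_pairing n p (A : 'M[R]_n) (B : 'M[R]_(n, p)) (c : R) :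
  (forall i j, `|A i j| <= c) ->
  `|\sum_(i < n) \sum_(j < p) B i j * (A *m B) i j| <= c * n%:R * sumsq B.
Proof.
move=> Ac.
(* Each term |B_ij A_ik B_kj| is at most c (B_ij^2 + B_kj^2) / 2. *)
have -> : c * n%:R * sumsq B =
    \sum_(i < n) \sum_(j < p) \sum_(k < n) c * ((B i j ^+ 2 + B k j ^+ 2) / 2).
  rewrite /sumsq.
  transitivity (c / 2 * (\sum_(i < n) \sum_(j < p) \sum_(k < n) B i j ^+ 2 +
                         \sum_(i < n) \sum_(j < p) \sum_(k < n) B k j ^+ 2)).
    have -> : \sum_(i < n) \sum_(j < p) \sum_(k < n) B k j ^+ 2 =
        n%:R * \sum_(i < n) \sum_(j < p) B i j ^+ 2.
      under eq_bigr do rewrite exchange_big.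
      by rewrite sumr_const card_ord mulr_natl.
    have -> : \sum_(i < n) \sum_(j < p) \sum_(k < n) B i j ^+ 2 =
        n%:R * \sum_(i < n) \sum_(j < p) B i j ^+ 2.
      rewrite mulr_sumr; apply: eq_bigr => i _; rewrite mulr_sumr.
      by apply: eq_bigr => j _; rewrite sumr_const card_ord mulr_natl.
    by set x := _%:R; set y := \sum_(i < n) _; field.
  rewrite -big_split/= mulr_sumr; apply: eq_bigr => i _.
  rewrite -big_split/= mulr_sumr; apply: eq_bigr => j _.
  rewrite -big_split/= mulr_sumr; apply: eq_bigr => k _.
  by field.
apply: (le_trans (ler_norm_sum _ _ _)); apply: ler_sum => i _.
apply: (le_trans (ler_norm_sum _ _ _)); apply: ler_sum => j _.
rewrite mxE mulr_sumr.
apply: (le_trans (ler_norm_sum _ _ _)); apply: ler_sum => k _.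
have h : `|B i j| * `|B k j| <= (B i j ^+ 2 + B k j ^+ 2) / 2.
  rewrite -(real_normK (num_real (B i j))) -(real_normK (num_real (B k j))).
  by have := sqr_ge0 (`|B i j| - `|B k j|); lra.
by rewrite mulrCA !normrM ler_pM// mulr_ge0.
Qed.

Lemma mulmx_entry_le m n p (A : 'M[R]_(m, n)) (B : 'M[R]_(n, p)) a b i j :
  (forall i j, `|A i j| <= a) -> (forall i j, `|B i j| <= b) ->
  `|(A *m B) i j| <= n%:R * (a * b).
Proof.
move=> Aa Bb; rewrite mxE (le_trans (ler_norm_sum _ _ _))//.
have -> : n%:R * (a * b) = \sum_(k < n) a * b.
  by rewrite sumr_const card_ord mulr_natl.
by apply: ler_sum => k _; rewrite normrM ler_pM.
Qed.

Lemma exists_entry_bound m n (A : 'M[R]_(m, n)) :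
  exists2 c, 0 <= c & forall i j, `|A i j| <= c.
Proof.
exists (Num.sqrt (sumsq A)); first exact: sqrtr_ge0.
by move=> i j; rewrite -sqrtr_sqr ler_wsqrtr// sqr_entry_le_sumsq.
Qed.

Lemma op_norm_le n (A : 'M[R]_n) c : 0 <= c -> (forall i j, `|A i j| <= c) ->
  op_norm A <= n%:R ^+ 2 * c.
Proof.
move=> c0 Ac; apply: ge_sup.
  exists (l2_norm (A *m 0)), 0 => //=; rewrite /l2_norm big1 ?sqrtr0 ?ler01//.
  by move=> i _; rewrite mxE expr0n.
move=> _ [v /= v1 <-].
have vb i j : `|v i j| <= 1.
  rewrite (ord1 j) (le_trans _ v1)// -sqrtr_sqr ler_wsqrtr//.
  by rewrite (bigD1 i)//= lerDl sumr_ge0// => *; exact: sqr_ge0.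
have Avb i : `|(A *m v) i ord0| <= n%:R * c.
  by rewrite -[c]mulr1; exact: mulmx_entry_le.
have nc0 : 0 <= n%:R * c :> R by rewrite mulr_ge0.
rewrite /l2_norm -(ger0_norm (_ : 0 <= n%:R ^+ 2 * c)); last first.
  by rewrite mulr_ge0// exprn_ge0.
rewrite -sqrtr_sqr ler_wsqrtr//.
apply: (@le_trans _ _ (\sum_(i < n) (n%:R * c) ^+ 2)).
  by apply: ler_sum => i _; exact: sqr_le_of_norm_le.
rewrite sumr_const card_ord -[leLHS]mulr_natl.
have [->|n0] := posnP n; first by rewrite !mul0r sqr_ge0.
have n1 : 1 <= n%:R :> R by rewrite ler1n.
have -> : (n%:R ^+ 2 * c) ^+ 2 = n%:R ^+ 2 * (n%:R * c) ^+ 2 :> R by ring.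
by rewrite ler_wpM2r ?sqr_ge0// expr2 ler_peMl// (le_trans ler01).
Qed.

End SumOfSquares.

(** * Energy estimate for the linear equation *)

Section Energy.
Context {R : realType}.

Lemma continuous_within_sum (I : Type) (s : seq I) (A : set R)
    (f : I -> R -> R) :
  (forall i, {within A, continuous (f i)}) ->
  {within A, continuous (fun x => \sum_(i <- s) f i x)}.
Proof.
by move=> fc; apply: continuous_big => [|i _]; [exact: add_continuous|exact: fc].
Qed.

Variables (n p : nat) (a b c : R) (alpha : R -> 'M[R]_n) (y : R -> 'M[R]_(n, p)).
Hypotheses (ab : a <= b)
  (alpha_le : forall t, t \in `]a, b[ -> forall i j, `|alpha t i j| <= c)
  (y_cont : forall i j, {within `[a, b], continuous (fun t => y t i j)})
  (y_deriv : forall t, t \in `]a, b[ -> forall i j,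
     is_derive t 1 (fun s => y s i j) ((alpha t *m y t) i j)).

Lemma is_derive_weighted_sumsq (k t : R) : t \in `]a, b[ ->
  is_derive t 1 (fun s => expR (k * s) * sumsq (y s))
    (expR (k * t) * (k * sumsq (y t) +
       2 * \sum_i \sum_j y t i j * (alpha t *m y t) i j)).
Proof.
move=> tab.
have dS : is_derive t 1 (fun s => sumsq (y s))
    (2 * \sum_i \sum_j y t i j * (alpha t *m y t) i j).
  have -> : (fun s => sumsq (y s)) =
      \sum_(i < n) \sum_(j < p) (fun s => y s i j) ^+ 2.
    apply/funext => s; rewrite fct_sumE; apply: eq_bigr => i _.
    by rewrite fct_sumE.
  rewrite mulr_sumr; apply: is_derive_sum => i.
  rewrite mulr_sumr; apply: is_derive_sum => j.
  have dy := y_deriv tab i j; apply: (is_derive_eq (is_deriveX 2 dy)).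
  by rewrite expr1 -[_ *: _]/(_ * _) mulrA.
have dk : is_derive t 1 (fun s : R => k * s) k.
  by apply: is_derive_eq; rewrite -[_ *: _]/(_ * _) mulr1.
have dE : is_derive t 1 (fun s => expR (k * s)) (expR (k * t) * k).
  exact: (@is_derive1_comp _ expR (fun s => k * s)).
apply: is_derive_eq; rewrite -![_ *: _]/(_ * _); ring.
Qed.

Lemma continuous_weighted_sumsq (k : R) :
  {within `[a, b], continuous (fun s => expR (k * s) * sumsq (y s))}.
Proof.
move=> x; apply: cvgM.
  apply: continuous_subspaceT => {}x; apply: continuous_comp.
    by apply: cvgMr; exact: cvg_id.
  exact: continuous_expR.
apply: continuous_within_sum => i; apply: continuous_within_sum => j {}x.
exact: (cvgM (@y_cont i j x) (@y_cont i j x)).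
Qed.

(** The weighted energy expR (k * s) * sumsq (y s) is nonincreasing for
    k = - 2 c n. *)
Lemma sumsq_growth :
  sumsq (y b) <= expR (2 * c * n%:R * (b - a)) * sumsq (y a).
Proof.
pose k := - (2 * c * n%:R).
pose g s := expR (k * s) * sumsq (y s).
have gba : g b <= g a.
  apply: (@ler0_derive1_le_cc _ g a b).
  - by move=> t tab; have [] := is_derive_weighted_sumsq k tab.
  - move=> t tab; rewrite derive1E.
    have [_ ->] := is_derive_weighted_sumsq k tab.
    rewrite pmulr_rle0 ?expR_gt0//.
    have := sumsq_mulmx_pairing (y t) (alpha_le tab).
    by rewrite ler_norml /k; lra.
  - exact: continuous_weighted_sumsq.
  - by rewrite in_itv/= lexx ab.
  - by rewrite in_itv/= lexx ab.
  - exact: ab.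
have -> : 2 * c * n%:R * (b - a) = k * a - k * b by rewrite /k; ring.
rewrite expRB mulrAC ler_pdivlMr ?expR_gt0// mulrC; exact: gba.
Qed.

(** The same energy is nondecreasing for k = 2 c n: a solution that vanishes at
    b vanishes at a. *)
Lemma sumsq_decay :
  sumsq (y a) <= expR (2 * c * n%:R * (b - a)) * sumsq (y b).
Proof.
pose k := 2 * c * n%:R.
pose g s := expR (k * s) * sumsq (y s).
have gba : g a <= g b.
  apply: (@ger0_derive1_le_cc _ g a b).
  - by move=> t tab; have [] := is_derive_weighted_sumsq k tab.
  - move=> t tab; rewrite derive1E.
    have [_ ->] := is_derive_weighted_sumsq k tab.
    rewrite pmulr_rge0 ?expR_gt0//.
    have := sumsq_mulmx_pairing (y t) (alpha_le tab).
    by rewrite ler_norml /k; lra.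
  - exact: continuous_weighted_sumsq.
  - by rewrite in_itv/= lexx ab.
  - by rewrite in_itv/= lexx ab.
  - exact: ab.
rewrite -/k mulrBr expRB mulrAC ler_pdivlMr ?expR_gt0// mulrC; exact: gba.
Qed.

End Energy.

(** * The evolution family *)

Section EntrywiseDerivative.
Context {R : realType} (m n : nat).
Implicit Types (D : set R) (f : R -> 'M[R]_(m.+1, n.+1)).

Lemma has_derivative_within_entry D f t l i j : has_derivative_within D f t l ->
  ((u - t)^-1 * (f u i j - f t i j)) @[u --> within D t^'] --> l i j.
Proof.
move=> dft; have := cvg_comp _ _ dft (@coord_continuous _ _ _ i j l).
by apply: cvg_trans; apply: near_eq_cvg; near=> u => /=; rewrite !mxE.
Unshelve. all: by end_near. Qed.

Lemma has_derivative_within_is_derive D f t l i j : nbhs t D ->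
  has_derivative_within D f t l -> is_derive t 1 (fun u => f u i j) (l i j).
Proof.
move=> Dt dft; have fl := has_derivative_within_entry (i := i) (j := j) dft.
suff cvl : (h^-1 *: (f (h *: 1 + t) i j - f t i j)) @[h --> 0^'] --> l i j.
  by apply: DeriveDef; [apply/cvg_ex; exists (l i j)|exact: cvg_lim].
apply/cvgrPdist_lt => e e0.
move/cvgrPdist_lt : fl => /(_ e e0); move=> {}fl; rewrite !near_withinE in fl.
have /nbhs_ballP[r /= r0 rt] : \forall u \near t, u != t ->
    `|l i j - (u - t)^-1 * (f u i j - f t i j)| < e.
  by near=> u => ut; apply: (near fl u) => //; near: u.
near=> h.
have h0 : h != 0 by near: h; exact: nbhs_dnbhs_neq.
have := rt (h + t); rewrite addrK [h *: 1]mulr1; apply.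
  rewrite /ball /= opprD addrCA subrr addr0 normrN.
  by near: h; exact: dnbhs0_lt.
by rewrite -subr_eq0 addrK.
Unshelve. all: by end_near. Qed.

Lemma has_derivative_within_continuous D f t l i j :
  has_derivative_within D f t l ->
  (f u i j) @[u --> within D (nbhs t)] --> f t i j.
Proof.
move=> dft; have fl := has_derivative_within_entry (i := i) (j := j) dft.
apply/cvgrPdist_lt => e e0.
move/cvgrPdist_lt : fl => /(_ 1 ltr01); move=> {}fl; rewrite !near_withinE in fl.
pose k := `|l i j| + 1.
have k0 : 0 < k by rewrite ltr_wpDl.
rewrite near_withinE; near=> u => Du.
have [->|ut] := eqVneq u t; first by rewrite subrr normr0.
have : `|l i j - (u - t)^-1 * (f u i j - f t i j)| < 1 by apply: (near fl u).
have ut0 : u - t != 0 by rewrite subr_eq0.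
set q := _^-1 * _ => lq.
have -> : f t i j - f u i j = (t - u) * q.
  by rewrite /q -(opprB u t) mulNr mulrA mulfV// mul1r opprB.
have qk : `|q| <= k.
  by rewrite -lerBlDl (le_trans (lerB_dist _ _))// distrC ltW.
rewrite normrM (le_lt_trans (ler_wpM2l _ qk))// -ltr_pdivlMr//.
by near: u; apply: nbhsx_ballx; rewrite divr_gt0.
Unshelve. all: by end_near. Qed.

End EntrywiseDerivative.

Section Evolution.
Context {R : realType} (d : nat).
Variables (alpha : R -> 'M[R]_d.+1) (Ev : R -> R -> 'M[R]_d.+1).
Hypothesis Ev_evolution : is_evolution alpha Ev.

Lemma evolution_refl s : 0 <= s -> Ev s s = 1%:M.
Proof. by move=> /Ev_evolution[]. Qed.

Lemma evolution_mul_is_derive p (X : 'M[R]_(d.+1, p)) (s t : R) i j :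
  0 <= s -> s < t ->
  is_derive t 1 (fun u => (Ev s u *m X) i j) ((alpha t *m (Ev s t *m X)) i j).
Proof.
move=> s0 st; have [_ /(_ t (ltW st)) dE] := Ev_evolution s0.
rewrite mulmxA mxE.
have -> : (fun u => (Ev s u *m X) i j) =
    \sum_k (fun u => Ev s u i k) * cst (X k j).
  by apply/funext => u; rewrite mxE fct_sumE.
apply: is_derive_sum => k.
have st_nbhs : nbhs t [set u | s <= u].
  by near=> u; apply: ltW; near: u; exact: lt_nbhsr.
have dEk := has_derivative_within_is_derive i k st_nbhs dE.
by apply: is_derive_eq; rewrite scaler0 add0r -[_ *: _]/(_ * _) mulrC.
Unshelve. all: by end_near. Qed.

Lemma evolution_mul_continuous p (X : 'M[R]_(d.+1, p)) (s t : R) i j : 0 <= s ->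
  {within `[s, t], continuous (fun u => (Ev s u *m X) i j)}.
Proof.
move=> s0.
have -> : (fun u => (Ev s u *m X) i j) = fun u => \sum_k Ev s u i k * X k j.
  by apply/funext => u; rewrite mxE.
apply: continuous_within_sum => k.
apply: (@continuous_subspaceW _ _ _ [set u | s <= u]).
  by move=> u /=; rewrite in_itv/= => /andP[].
apply/subspace_continuousP => u su.
have [_ /(_ u su) dE] := Ev_evolution s0.
by apply: cvgMl; exact: has_derivative_within_continuous dE.
Qed.

Variable c : R.
Hypothesis alpha_le : forall t, 0 <= t -> forall i j, `|alpha t i j| <= c.

Lemma sumsq_evolution_mul p (X : 'M[R]_(d.+1, p)) (s t : R) : 0 <= s -> s <= t ->
  sumsq (Ev s t *m X) <= expR (2 * c * d.+1%:R * (t - s)) * sumsq X.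
Proof.
move=> s0 st; rewrite -{2}[X]mul1mx -(evolution_refl s0).
apply: (sumsq_growth (alpha := alpha) (y := fun u => Ev s u *m X)) => //.
- move=> u; rewrite in_itv/= => /andP[su _]; apply: alpha_le.
  by rewrite ltW// (le_lt_trans s0).
- by move=> i j; exact: evolution_mul_continuous.
- move=> u; rewrite in_itv/= => /andP[su _] i j.
  exact: evolution_mul_is_derive.
Qed.

(** A matrix X with Ev s t *m X = 0 vanishes, since u |-> Ev s u *m X decays at
    most exponentially; this is applied to the cokernel of Ev s t. *)
Lemma evolution_unitmx (s t : R) : 0 <= s -> s <= t -> Ev s t \in unitmx.
Proof.
move=> s0 st; rewrite -row_full_unit -cokermx_eq0; apply/eqP/sumsq_le0.
set X := cokermx _; rewrite -{1}[X]mul1mx -(evolution_refl s0).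
have : sumsq (Ev s s *m X) <=
    expR (2 * c * d.+1%:R * (t - s)) * sumsq (Ev s t *m X).
  apply: (sumsq_decay (alpha := alpha) (y := fun u => Ev s u *m X)) => //.
  - move=> u; rewrite in_itv/= => /andP[su _]; apply: alpha_le.
    by rewrite ltW// (le_lt_trans s0).
  - by move=> i j; exact: evolution_mul_continuous.
  - move=> u; rewrite in_itv/= => /andP[su _] i j.
    exact: evolution_mul_is_derive.
by rewrite mulmx_coker sumsq0 mulr0.
Qed.

Lemma evolution_unique p (y : R -> 'M[R]_(d.+1, p)) (s t : R) : 0 <= s -> s <= t ->
  (forall i j, {within `[s, t], continuous (fun u => y u i j)}) ->
  (forall u, u \in `]s, t[ -> forall i j,
     is_derive u 1 (fun u => y u i j) ((alpha u *m y u) i j)) ->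
  y t = Ev s t *m y s.
Proof.
move=> s0 st yc yd; apply/eqP; rewrite -subr_eq0; apply/eqP/sumsq_le0.
pose z u := y u - Ev s u *m y s.
have subE (A B : 'M[R]_(d.+1, p)) i j : (A - B) i j = A i j - B i j.
  by rewrite !mxE.
have : sumsq (z t) <= expR (2 * c * d.+1%:R * (t - s)) * sumsq (z s).
  apply: (sumsq_growth (alpha := alpha)) => //.
  - move=> u; rewrite in_itv/= => /andP[su _]; apply: alpha_le.
    by rewrite ltW// (le_lt_trans s0).
  - move=> i j.
    have -> : (fun u => z u i j) = fun u => y u i j - (Ev s u *m y s) i j.
      by apply/funext => u; rewrite /z subE.
    move=> u; apply: cvgB; first exact: yc.
    exact: evolution_mul_continuous.
  - move=> u ust i j; have /andP[su _] := ust.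
    have -> : (fun u => z u i j) =
       (fun u => y u i j) - (fun u => (Ev s u *m y s) i j).
      by apply/funext => w; rewrite /z subE.
    rewrite mulmxBr subE.
    by apply: is_deriveB; [exact: yd|exact: evolution_mul_is_derive].
by rewrite {2}/z evolution_refl// mul1mx subrr sumsq0 mulr0.
Qed.

End Evolution.

(** * Zeros and excursions *)

Section Zeros.
Context {R : realType}.

Lemma closed_inf_mem (A : set R) : closed A -> has_inf A -> A (inf A).
Proof.
move=> cA iA; apply: cA => B /nbhs_ballP[e /= e0 eB].
have [s As sA] := inf_adherent e0 iA; exists s; split => //; apply: eB.
rewrite /ball/= distrC ger0_norm ?subr_ge0 ?ge_inf//; last by case: iA.
by rewrite ltrBlDl.
Qed.

Variable beta : R -> R.
Hypothesis beta_cont : {within [set t : R | 0 <= t], continuous beta}.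

Lemma closed_zeros : closed (zeros beta).
Proof.
have -> : zeros beta = (beta @^-1` [set 0]) `&` [set t : R | 0 <= t].
  by apply/seteqP; split=> t /=; [move=> []|case].
rewrite closed_setIS; last exact: closed_ge.
move/continuous_closedP : beta_cont; apply; exact: closed_eq.
Qed.

Lemma sigma0_le z : zeros beta z -> (sigma0 beta <= z%:E)%E.
Proof. by move=> Zz; apply: ereal_inf_lbound; exists z. Qed.

Lemma sigma0_ge0 : (0 <= sigma0 beta)%E.
Proof. by apply: le_ereal_inf_tmp => _ [s [s0 _] <-]; rewrite lee_fin. Qed.

Lemma sigma0_zero t : (sigma0 beta <= t%:E)%E ->
  zeros beta (fine (sigma0 beta)) /\ sigma0 beta = (fine (sigma0 beta))%:E.
Proof.
move=> St; have Zne : zeros beta !=set0.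
  apply/set0P/eqP => Z0; move: St; rewrite /sigma0 Z0 image_set0 ereal_inf0.
  by rewrite leye_eq.
have lZ : has_lbound (zeros beta) by exists 0 => s [].
rewrite /sigma0 ereal_inf_EFin//=; split=> //.
exact: closed_inf_mem closed_zeros _.
Qed.

Lemma tau_zero z t : zeros beta z -> z <= t ->
  [/\ zeros beta (tau beta t), tau beta t <= t &
      forall s, zeros beta s -> s <= t -> s <= tau beta t].
Proof.
move=> Zz zt; set A := [set s | s <= t /\ zeros beta s].
have uA : has_ubound A by exists t => s [].
have Ane : A !=set0 by exists z.
have cA : closed A by apply: closedI; [exact: closed_le|exact: closed_zeros].
have [ltau Ztau] : A (sup A) by apply: cA; exact: closure_sup.
by split=> // s Zs st; apply: ub_le_sup.
Qed.

Lemma tau_eq a t : zeros beta a -> a <= t ->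
  (forall s, a < s -> s <= t -> ~ zeros beta s) -> tau beta t = a.
Proof.
move=> Za at_ nZ; have [Zt tt ltau] := tau_zero Za at_.
apply/eqP; rewrite eq_le ltau// andbT leNgt; apply/negP => h.
exact: (nZ _ h tt Zt).
Qed.

(** The excursion around s joins the last zero before s to the first zero after
    s; the zero z bounds it on the right. *)
Lemma excursion_exists s z : 0 <= s -> beta s != 0 ->
  (sigma0 beta <= s%:E)%E -> zeros beta z -> s <= z ->
  exists p, [/\ excursion beta p, s \in `]p.1, p.2[ & p.2 <= z].
Proof.
move=> s0 bs Ss Zz sz.
have [Z0 S0E] := sigma0_zero Ss.
have z0s : fine (sigma0 beta) <= s by rewrite -lee_fin -S0E.
have [Za as_ aub] := tau_zero Z0 z0s; set a := tau beta s in Za as_ aub.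
pose B := [set u | s <= u /\ zeros beta u].
have iB : has_inf B by split; [exists z|exists s => u []].
have cB : closed B by apply: closedI; [exact: closed_ge|exact: closed_zeros].
have [sb Zb] := closed_inf_mem cB iB; set b := inf B in sb Zb.
have nsZ : ~ zeros beta s by move=> [_ /eqP]; exact/negP.
have ltas : a < s.
  by rewrite lt_neqAle as_ andbT; apply/eqP => h; apply: nsZ; rewrite -h.
have ltsb : s < b.
  by rewrite lt_neqAle sb andbT; apply/eqP => h; apply: nsZ; rewrite h.
have blb u : zeros beta u -> s <= u -> b <= u.
  by move=> Zu su; apply: ge_inf => //; case: iB.
exists (a, b); split; last exact: blb.
- split=> /=; first exact: lt_trans ltsb.
    exact: sigma0_le.
  exists s; first by [].
  set C := connected_component _ _.
  have Cint : is_interval C.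
    by apply/connected_intervalP; exact: component_connected.
  have Cs : C s by apply: connected_component_refl.
  have CZ : forall u, C u -> ~ zeros beta u.
    by move=> u /connected_component_sub[_ /eqP] /[swap] -[].
  apply/seteqP; split=> [u Cu|].
    rewrite /= in_itv/=; apply/andP; split.
      rewrite ltNge; apply/negP => ua; apply: (CZ a) => //.
      by apply: (Cint u s) => //; rewrite ua ltW.
    rewrite ltNge; apply/negP => bu; apply: (CZ b) => //.
    by apply: (Cint s u) => //; rewrite bu ltW.
  apply: connected_component_max.
  - by rewrite /= in_itv/= ltas.
  - move=> u /=; rewrite in_itv/= => /andP[au ub].
    have u0 : 0 <= u by case: Za => a0 _; rewrite (le_trans a0)// ltW.
    split=> //; apply/eqP => bu.
    have Zu : zeros beta u by [].
    have [us|su] := leP u s.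
      by have := aub u Zu us; rewrite leNgt au.
    by have := blb u Zu (ltW su); rewrite leNgt ub.
  - by apply/connected_intervalP; exact: interval_is_interval.
- by rewrite in_itv/= ltas.
Qed.

Lemma excursion_zeros p : excursion beta p ->
  [/\ zeros beta p.1, zeros beta p.2 &
      forall s, s \in `]p.1, p.2[ -> ~ zeros beta s].
Proof.
move=> [p12 Sp [x Zx Cp]].
set Z := [set t | 0 <= t /\ beta t != 0] in Zx Cp.
have p0 : 0 <= p.1 by rewrite -lee_fin (le_trans sigma0_ge0).
have CZ s : s \in `]p.1, p.2[ -> Z s.
  by move=> sp; apply: (@connected_component_sub _ _ x); rewrite Cp.
have /andP[px xp] : p.1 < x < p.2.
  have : connected_component Z x x by apply: connected_component_refl.
  by rewrite Cp /= in_itv.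
(* A subinterval of Z that contains x lies in the component of x; an endpoint
   in Z could therefore be added to the open interval. *)
have extend (i : interval R) : x \in i -> [set` i] `<=` Z ->
    [set` i] `<=` [set` `]p.1, p.2[].
  move=> xi iZ; rewrite -Cp; apply: connected_component_max => //.
  by apply/connected_intervalP; exact: interval_is_interval.
split.
- split=> //; apply/eqP/negPn/negP => b1.
  have : p.1 \in `]p.1, p.2[ .
    apply: (extend `[p.1, p.2[); last by rewrite /= in_itv/= lexx.
      by rewrite in_itv/= xp ltW.
    move=> s /=; rewrite in_itv/= le_eqVlt => /andP[/predU1P[<-//|ps] sp].
    by apply: CZ; rewrite in_itv/= ps.
  by rewrite in_itv/= ltxx.
- have p20 : 0 <= p.2 by rewrite (le_trans p0)// ltW.
  split=> //; apply/eqP/negPn/negP => b2.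
  have : p.2 \in `]p.1, p.2[ .
    apply: (extend `]p.1, p.2]); last by rewrite /= in_itv/= lexx p12.
      by rewrite in_itv/= px ltW.
    move=> s /=; rewrite in_itv/= le_eqVlt => /andP[ps /predU1P[->//|sp]].
    by apply: CZ; rewrite in_itv/= ps.
  by rewrite in_itv/= ltxx andbF.
- by move=> s /CZ[_ /eqP] /[swap] -[].
Qed.

Lemma excursions_separated p q : excursion beta p -> excursion beta q ->
  p != q -> p.2 <= q.1 \/ q.2 <= p.1.
Proof.
move=> ep exq; apply: contra_neqP => /not_orP[/negP + /negP].
rewrite -!ltNge => qp pq.
have [p12 _ _] := ep; have [q12 _ _] := exq.
have [Zp1 Zp2 nZp] := excursion_zeros ep.
have [Zq1 Zq2 nZq] := excursion_zeros exq.
have E1 : p.1 = q.1.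
  case: (ltgtP p.1 q.1) => // h.
    by case: (nZp q.1) => //; rewrite in_itv/= h.
  by case: (nZq p.1) => //; rewrite in_itv/= h.
have E2 : p.2 = q.2.
  case: (ltgtP p.2 q.2) => // h.
    by case: (nZq p.2) => //; rewrite in_itv/= h -E1 p12.
  by case: (nZp q.2) => //; rewrite in_itv/= h E1 q12.
by rewrite (surjective_pairing p) E1 E2 -surjective_pairing.
Qed.

End Zeros.

(** * Finitely many excursions exhaust almost all of the length *)

Section Covering.
Context {R : realType}.
Notation mu := (@lebesgue_measure R).

Lemma lebesgue_measure_cover_le (A V : set R) (l : seq (R * R)) :
  measurable A -> measurable V -> (forall p, p \in l -> p.1 < p.2) ->
  (forall s, A s -> V s \/ exists2 p, p \in l & s \in `]p.1, p.2[) ->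
  (mu A <= mu V + (\sum_(p <- l) (p.2 - p.1))%:E)%E.
Proof.
move=> mA; elim: l V => [|p l IH] V mV lp Acov.
  rewrite big_nil adde0; apply: le_measure; rewrite ?inE//.
  by move=> s /Acov[//|[]].
have mp : measurable (`]p.1, p.2[%classic : set R) by exact: measurable_itv.
have mVp : measurable (V `|` `]p.1, p.2[%classic) by exact: measurableU.
apply: (le_trans (IH _ mVp _ _)).
- by move=> q ql; apply: lp; rewrite inE ql orbT.
- move=> s /Acov[Vs|[q]]; first by left; left.
  by rewrite inE => /predU1P[->|ql] sq; [left; right|right; exists q].
rewrite big_cons EFinD addeA leeD2r//.
have muVp : (mu (V `|` `]p.1, p.2[) <= mu V + mu `]p.1, p.2[)%E.
  exact: measureU2.
rewrite (le_trans muVp)// leeD2l//.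
by rewrite lebesgue_measure_itv/= lte_fin lp ?mem_head// EFinB.
Qed.

Variable beta : R -> R.
Hypothesis beta_cont : {within [set t : R | 0 <= t], continuous beta}.
Hypothesis zeros_null : mu (zeros beta) = 0%E.

(** The null set of zeros lies in an open set of measure at most e, which
    together with the excursions covers the compact interval from sigma0 to z.
    The bound holds for every list that contains the finite family L0. *)
Lemma finite_excursions_almost_cover z e : zeros beta z -> 0 < e ->
  exists2 L0 : {fset R * R},
    forall p, p \in L0 -> excursion beta p /\ p.2 <= z &
    forall l : seq (R * R), (forall p, p \in l -> p.1 < p.2) ->
      {subset L0 <= l} ->
      z - fine (sigma0 beta) <= e + \sum_(p <- l) (p.2 - p.1).
Proof.
move=> Zz e0; set z0 := fine _.
have [Z0 S0] := sigma0_zero beta_cont (sigma0_le Zz).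
have mZ : measurable (zeros beta).
  by apply: measurable_realfun.closed_measurable; exact: closed_zeros.
have [|V [oV ZV Ve]] := @lebesgue_regularity_outer _ (zeros beta) e mZ _ e0.
  by rewrite [X in (X < _)%E]zeros_null.
have mV : measurable V by exact: measurable_realfun.open_measurable.
have {}Ve : (mu V <= e%:E)%E.
  have -> : V = zeros beta `|` (V `\` zeros beta) by rewrite setDUK.
  have mD : measurable (V `\` zeros beta) by exact: measurableD.
  have muU : (mu (zeros beta `|` (V `\` zeros beta)) <=
      mu (zeros beta) + mu (V `\` zeros beta))%E by exact: measureU2.
  by apply: (le_trans muU); rewrite zeros_null add0e; exact: ltW.
(* The cover is indexed by the excursions, and None stands for V. *)
pose D := [set o : option (R * R) |
  if o is Some p then excursion beta p /\ p.2 <= z else True].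
pose f (o : option (R * R)) : set R :=
  if o is Some p then `]p.1, p.2[%classic else V.
have : cover_compact (`[z0, z]%classic : set R).
  by rewrite -compact_cover; exact: segment_compact.
move=> /(_ _ D f)[].
- by move=> [p|] _ /=; [exact: interval_open|].
- move=> s /=; rewrite in_itv/= => /andP[z0s sz].
  have [Zs|nZs] := pselect (zeros beta s); first by exists None => //; exact: ZV.
  have s0 : 0 <= s by case: Z0 => ? _; exact: le_trans z0s.
  have bs : beta s != 0 by apply/eqP => bs; exact: nZs.
  have [|p [ep sp pz]] := excursion_exists beta_cont s0 bs _ Zz sz.
    by rewrite S0 lee_fin.
  by exists (Some p).
move=> D' D'D cov.
exists [fset p in pmap id (enum_fset D')]%fset.
  move=> p; rewrite inE/= mem_pmap map_id => pD'.
  by have := D'D _ pD'; rewrite inE.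
move=> l lp Ll; rewrite -lee_fin EFinB.
have [z0z|zz0] := ltP z0 z; last first.
  rewrite -EFinB lee_fin (@le_trans _ _ 0) ?subr_le0//.
  apply: addr_ge0; first exact: ltW.
  by rewrite big_seq; apply: sumr_ge0 => p /lp; rewrite subr_ge0 => /ltW.
have := @lebesgue_measure_cover_le `[z0, z]%classic V l.
rewrite lebesgue_measure_itv/= lte_fin z0z => -/(_ _ mV lp) h.
apply: (le_trans (h _ _)); first exact: measurable_itv.
  move=> s /cov[[p|] /= pD' sp]; last by left.
  right; exists p => //; apply: Ll.
  by rewrite inE/= mem_pmap map_id.
by rewrite EFinD leeD2r.
Qed.

End Covering.

(** * Telescoping of ordered products *)

Section OrderedProducts.
Context {R : realType} (d : nat).
Variable A : R * R -> 'M[R]_d.+1.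

Lemma prod_rev_cons_mul p (X : 'M[R]_(d.+1, p)) (q : R * R) l :
  (\prod_(k <- rev (q :: l)) A k) *m X = (\prod_(k <- rev l) A k) *m (A q *m X).
Proof. by rewrite rev_cons -cats1 big_cat/= big_seq1 mulmxA mulmxE. Qed.

Variable M : R.
Hypothesis M_ge0 : 0 <= M.

Lemma sumsq_prod_le (l : seq (R * R)) (X : 'M[R]_d.+1) :
  (forall q, q \in l -> forall X : 'M[R]_d.+1,
     sumsq (A q *m X) <= expR (M * (q.2 - q.1)) * sumsq X) ->
  sumsq ((\prod_(k <- rev l) A k) *m X) <=
    expR (M * \sum_(q <- l) (q.2 - q.1)) * sumsq X.
Proof.
elim: l X => [|q l IH] X Al; first by rewrite !big_nil mulr0 expR0 mul1r mul1mx.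
rewrite prod_rev_cons_mul (le_trans (IH _ _))//.
  by move=> r rl; apply: Al; rewrite inE rl orbT.
rewrite big_cons mulrDr addrC expRD -mulrA ler_wpM2l ?expR_ge0//.
by apply: Al; rewrite mem_head.
Qed.

(** The growth is controlled for the sum of squares of the whole product, so the
    dimensional constant d.+1 enters once and not once per factor. *)
Lemma prod_entry_le (l : seq (R * R)) (X : 'M[R]_d.+1) (T c : R) :
  (forall q, q \in l -> forall X : 'M[R]_d.+1,
     sumsq (A q *m X) <= expR (M * (q.2 - q.1)) * sumsq X) ->
  \sum_(q <- l) (q.2 - q.1) <= T -> 0 <= T ->
  0 <= c -> (forall i j, `|X i j| <= c) -> forall i j,
  `|((\prod_(k <- rev l) A k) *m X) i j| <= d.+1%:R * expR (M * T) * c.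
Proof.
move=> Al lT T0 c0 Xc i j.
have B0 : 0 <= d.+1%:R * expR (M * T) * c by rewrite !mulr_ge0 ?expR_ge0.
rewrite -(ger0_norm B0) -!sqrtr_sqr ler_wsqrtr//.
rewrite (le_trans (sqr_entry_le_sumsq _ _ _))//.
rewrite (le_trans (sumsq_prod_le _ Al))//.
apply: (@le_trans _ _ (expR (M * T) * (d.+1%:R * d.+1%:R * c ^+ 2))).
  rewrite ler_pM ?expR_ge0 ?sumsq_ge0 ?sumsq_le//.
  by rewrite ler_expR ler_wpM2l.
have E1 : 1 <= expR (M * T) by rewrite -expR0 ler_expR mulr_ge0.
have -> : (d.+1%:R * expR (M * T) * c) ^+ 2 =
   expR (M * T) * (expR (M * T) * (d.+1%:R * d.+1%:R * c ^+ 2)) by ring.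
by rewrite ler_peMl// !mulr_ge0 ?expR_ge0 ?sqr_ge0.
Qed.

(** The factors carry x exactly over the intervals of l; the error comes from the
    gaps between them, where x moves by at most C times the length. *)
Lemma telescoping_bound (x : R -> 'M[R]_d.+1) (l : seq (R * R)) (T C a z : R) :
  0 <= C -> 0 <= a -> a <= z -> z <= T ->
  (forall q, q \in l -> forall X : 'M[R]_d.+1,
     sumsq (A q *m X) <= expR (M * (q.2 - q.1)) * sumsq X) ->
  (forall q, q \in l -> x q.2 = A q *m x q.1) ->
  (forall u v i j, 0 <= u -> u <= v -> v <= T ->
     `|(x v - x u) i j| <= C * (v - u)) ->
  (forall q, q \in l -> [/\ a <= q.1, q.1 < q.2 & q.2 <= z]) ->
  pairwise (fun p q => p.2 <= q.1) l ->
  \sum_(q <- l) (q.2 - q.1) <= z - a /\ forall i j,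
  `|(x z - (\prod_(k <- rev l) A k) *m x a) i j| <=
     d.+1%:R * expR (M * T) * (C * (z - a - \sum_(q <- l) (q.2 - q.1))).
Proof.
move=> C0 + + zT + + xlip.
have B1 : 0 <= T -> 1 <= d.+1%:R * expR (M * T).
  move=> T0; rewrite -[leLHS]mul1r ler_pM ?ler1n//.
  by rewrite -expR0 ler_expR mulr_ge0.
elim: l a => [|q l IH] a a0 az Al xA lz ls.
  rewrite !big_nil subr_ge0; split=> // i j; rewrite mul1mx subr0.
  rewrite (le_trans (xlip _ _ i j a0 az zT))// ler_peMl//.
    by rewrite mulr_ge0 ?subr_ge0.
  by rewrite B1// (le_trans _ zT)// (le_trans a0).
have [aq qq qz] := lz q (mem_head _ _).
have Al' r : r \in l -> forall X : 'M[R]_d.+1,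
    sumsq (A r *m X) <= expR (M * (r.2 - r.1)) * sumsq X.
  by move=> rl; apply: Al; rewrite inE rl orbT.
have [||||||S1 bnd] := IH q.2.
- by rewrite (le_trans a0)// (le_trans aq)// ltW.
- by [].
- exact: Al'.
- by move=> r rl; apply: xA; rewrite inE rl orbT.
- move=> r rl; have [_ rr rz] : [/\ a <= r.1, r.1 < r.2 & r.2 <= z].
    by apply: lz; rewrite inE rl orbT.
  split=> //.
  by move: ls; rewrite pairwise_cons => /andP[/allP/(_ _ rl)].
- by move: ls; rewrite pairwise_cons => /andP[].
rewrite big_cons.
have Sa : q.2 - q.1 + \sum_(r <- l) (r.2 - r.1) <= z - a.
  by move: S1 aq; lra.
split=> // i j.
have T0 : 0 <= T by rewrite (le_trans _ zT)// (le_trans a0).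
(* Since x q.2 = A q *m x q.1, replacing x a by x q.1 under the product over
   q :: l turns it into the product over l applied to x q.2. *)
have -> : x z - (\prod_(k <- rev (q :: l)) A k) *m x a =
    (x z - (\prod_(k <- rev l) A k) *m x q.2) +
    (\prod_(k <- rev (q :: l)) A k) *m (x q.1 - x a).
  rewrite mulmxBr !(prod_rev_cons_mul _ q) xA ?mem_head//.
  by rewrite addrA subrK.
rewrite mxE (le_trans (ler_normD _ _))//.
have h1 := bnd i j.
have h2 : `|((\prod_(k <- rev (q :: l)) A k) *m (x q.1 - x a)) i j| <=
    d.+1%:R * expR (M * T) * (C * (q.1 - a)).
  apply: prod_entry_le => //.
  - rewrite big_cons (le_trans Sa)//; lra.
  - by rewrite mulr_ge0// subr_ge0.
  - move=> i' j'; apply: xlip => //.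
    by rewrite (le_trans _ zT)// (le_trans _ qz)// ltW.
move: (lerD h1 h2) => /le_trans; apply; rewrite -mulrDr -mulrDr.
by rewrite le_eqVlt; apply/orP; left; apply/eqP; congr (_ * (_ * _)); ring.
Qed.

(** [itv_le] is neither total nor transitive in general; it is both on pairwise
    separated nondegenerate intervals. *)
Lemma sort_itv_le_pairwise (L : {fset R * R}) :
  (forall p, p \in L -> p.1 < p.2) ->
  (forall p q, p \in L -> q \in L -> p != q -> p.2 <= q.1 \/ q.2 <= p.1) ->
  pairwise (fun p q => p.2 <= q.1) (sort (@itv_le R) (enum_fset L)).
Proof.
move=> L12 Ltot; set s := sort _ _.
have sL p : p \in s -> p \in L by rewrite mem_sort.
have sLall : all [in L] s by apply/allP => p /sL.
have tot : {in [in L] &, total (@itv_le R)}.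
  move=> p q pL qL; rewrite /itv_le /=.
  have [//|pq] := eqVneq p q.
  by apply/orP; case: (Ltot p q pL qL pq) => ->; rewrite ?orbT; [left|right].
have tr : {in [in L] & &, transitive (@itv_le R)}.
  move=> q p r qL pL rL; rewrite /itv_le.
  move=> /predU1P[->//|pq] /predU1P[<-|qr]; first by rewrite pq orbT.
  by rewrite (le_trans (le_trans pq (ltW (L12 _ qL))) qr) orbT.
have : sorted (@itv_le R) s.
  by apply: (sort_sorted_in tot); apply/allP => p.
rewrite (sorted_pairwise_in tr sLall) => pw.
have : uniq s by rewrite sort_uniq fset_uniq.
rewrite uniq_pairwise => un.
have : pairwise [rel p q | itv_le p q && (p != q)] s by rewrite pairwise_relI pw.
by apply: sub_pairwise => p q /= /andP[/predU1P[->|//]]; rewrite eqxx.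
Qed.

End OrderedProducts.

(** * Integrals over segments and the projections P and Q *)

Section IntegralOverSegments.
Context {R : realType}.
Notation mu := (@lebesgue_measure R).
Implicit Types (f : R -> R) (u v w : R).

Lemma integrable_subsegment f u v u' v' : u <= u' -> v' <= v ->
  mu.-integrable `[u, v] (EFin \o f) -> mu.-integrable `[u', v'] (EFin \o f).
Proof.
move=> uu vv; apply: integrableS; [exact: measurable_itv..|].
by apply: subset_itv; rewrite bnd_simp.
Qed.

Lemma Rintegral_segment_split f u v w : u <= v -> v <= w ->
  mu.-integrable `[u, w] (EFin \o f) ->
  \int[mu]_(s in `[u, w]) f s =
  \int[mu]_(s in `[u, v]) f s + \int[mu]_(s in `[v, w]) f s.
Proof.
move=> uv vw fi; apply/eqP; rewrite addrC -subr_eq; apply/eqP.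
rewrite Rintegral_itvB ?bnd_simp// Rintegral_itv_obnd_cbnd//.
apply: integrableS fi; [exact: measurable_itv..|].
by apply: subset_itv; rewrite bnd_simp.
Qed.

Lemma normr_Rintegral_subsegment_le f u v u' v' :
  u <= u' -> u' <= v' -> v' <= v -> mu.-integrable `[u, v] (EFin \o f) ->
  `|\int[mu]_(s in `[u', v']) f s| <= \int[mu]_(s in `[u, v]) `|f s|.
Proof.
move=> uu uv vv fi.
have fi' : mu.-integrable `[u', v'] (EFin \o f) by exact: integrable_subsegment fi.
have nfi : mu.-integrable `[u, v] (EFin \o (fun s => `|f s|)).
  exact: integrable_abse fi.
have uv' : u' <= v by rewrite (le_trans uv).
rewrite (le_trans (le_normr_Rintegral _ fi'))//.
rewrite (Rintegral_segment_split uu uv' nfi).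
rewrite (Rintegral_segment_split uv vv); last exact: integrable_subsegment nfi.
by rewrite addrCA lerDl addr_ge0// Rintegral_ge0.
Qed.

Lemma normr_Rintegral_segment_le f u v c : u <= v ->
  mu.-integrable `[u, v] (EFin \o f) ->
  (forall s, s \in `[u, v] -> `|f s| <= c) ->
  `|\int[mu]_(s in `[u, v]) f s| <= c * (v - u).
Proof.
move=> uv fi fc.
have muv : mu `[u, v] = (v - u)%:E.
  rewrite lebesgue_measure_itv/= lte_fin; case: ltgtP uv => // -> _.
  by rewrite subrr.
have -> : c * (v - u) = \int[mu]_(s in `[u, v]) (cst c s).
  by rewrite Rintegral_cst//= [X in fine X]muv.
rewrite (le_trans (le_normr_Rintegral _ fi))//.
apply: le_Rintegral => //; first exact: integrable_abse fi.
apply: measurable_bounded_integrable => //.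
  by rewrite [X in (X < _)%E]muv ltry.
exists `|c|; split; first exact: num_real.
by move=> x cx s _ /=; exact: ltW.
Qed.

End IntegralOverSegments.

Section Projections.
Context {R : realType} (d : nat).
Implicit Types A : 'M[R]_d.+1.
Local Notation P := (matP R d).
Local Notation Q := (matQ R d).

Lemma matP_mulE A i j : (P *m A) i j = (i != ord_max)%:R * A i j.
Proof. by rewrite /matP mul_diag_mx !mxE. Qed.

Lemma matQ_mulE A i j : (Q *m A) i j = (i == ord_max)%:R * A i j.
Proof.
rewrite /matQ mulmxBl mul1mx mxE [X in _ + X]mxE matP_mulE.
by case: eqP => _; rewrite ?(mul0r, mul1r, subr0, subrr).
Qed.

Lemma matPP : P *m P = P.
Proof.
apply/matrixP => i j; rewrite matP_mulE; case: eqP => [->|]; last by rewrite mul1r.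
by rewrite mul0r /matP !mxE eqxx mul0rn.
Qed.

Lemma sumsq_matP_le A : sumsq (P *m A) <= sumsq A.
Proof.
apply: ler_sum => i _; apply: ler_sum => j _; rewrite matP_mulE.
by case: (_ != _); rewrite ?mul1r// mul0r expr0n sqr_ge0.
Qed.

End Projections.

(** * The solution between consecutive zeros *)

Section Solution.
Context {R : realType} (d : nat).
Notation mu := (@lebesgue_measure R).
Variables (alpha : R -> 'M[R]_d.+1) (beta : R -> R) (gamma : R -> 'M[R]_d.+1).
Hypothesis beta_cont : {within [set t : R | 0 <= t], continuous beta}.
Hypothesis gamma_solution : is_solution alpha beta gamma.
Local Notation P := (matP R d).
Local Notation Q := (matQ R d).

(** The entries of the integrand alpha gamma. *)
Definition drift i j (s : R) : R := (alpha s *m gamma s) i j.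

Lemma integrable_drift u v i j : 0 <= u -> u <= v ->
  mu.-integrable `[u, v] (EFin \o drift i j).
Proof.
move=> u0 uv; apply: (@integrable_subsegment _ _ 0 v) => //.
by have [gi _ _] := gamma_solution (le_trans u0 uv); exact: gi.
Qed.

Lemma mx_integral_matP u v i j : i != ord_max ->
  mx_integral u v (fun s => P *m alpha s *m gamma s) i j =
  \int[mu]_(s in `[u, v]) drift i j s.
Proof.
move=> im; rewrite mxE; apply: eq_Rintegral => s _.
by rewrite -mulmxA matP_mulE im mul1r.
Qed.

Lemma mx_integral_matQ u v j :
  mx_integral u v (fun s => Q *m alpha s *m gamma s) ord_max j =
  \int[mu]_(s in `[u, v]) drift ord_max j s.
Proof.
rewrite mxE; apply: eq_Rintegral => s _.
by rewrite -mulmxA matQ_mulE eqxx mul1r.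
Qed.

(** The entries of the rows fixed by P satisfy an integral equation without
    resets. *)
Lemma solution_upper_entry t i j : 0 <= t -> i != ord_max ->
  gamma t i j = (i == j)%:R + \int[mu]_(s in `[0, t]) drift i j s.
Proof.
move=> t0 im; have [_ + _] := gamma_solution t0.
move=> /matrixP/(_ i j); rewrite matP_mulE im mul1r => ->.
rewrite mxE mx_integral_matP//; congr (_ + _).
by rewrite -[P]mulmx1 matP_mulE im mul1r mxE.
Qed.

(** The last row restarts from 0 at each zero. *)
Lemma solution_last_entry t j : 0 <= t ->
  gamma t ord_max j = if (t%:E < sigma0 beta)%E
    then (ord_max == j)%:R + \int[mu]_(s in `[0, t]) drift ord_max j s
    else \int[mu]_(s in `[tau beta t, t]) drift ord_max j s.
Proof.
move=> t0; have [_ _ +] := gamma_solution t0.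
move=> /matrixP/(_ ord_max j); rewrite matQ_mulE eqxx mul1r => ->.
case: ifP => _; last by rewrite mx_integral_matQ.
rewrite mxE mx_integral_matQ; congr (_ + _).
by rewrite -[Q]mulmx1 matQ_mulE eqxx mul1r mxE.
Qed.

Lemma solution_upper_increment u v i j : 0 <= u -> u <= v -> i != ord_max ->
  gamma v i j = gamma u i j + \int[mu]_(s in `[u, v]) drift i j s.
Proof.
move=> u0 uv im; rewrite !solution_upper_entry// ?(le_trans u0)//.
rewrite (Rintegral_segment_split u0 uv) ?addrA//.
by apply: integrable_drift; rewrite // (le_trans u0).
Qed.

Lemma solution_at0 : (0 < sigma0 beta)%E -> gamma 0 = 1%:M.
Proof.
move=> S0; apply/matrixP => i j; rewrite mxE.
have [->|im] := eqVneq i ord_max.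
  by rewrite solution_last_entry// S0 set_itv1 Rintegral_set1 addr0.
by rewrite solution_upper_entry// set_itv1 Rintegral_set1 addr0.
Qed.

Lemma solution_before_sigma0 v i j : 0 <= v -> (v%:E < sigma0 beta)%E ->
  gamma v i j = gamma 0 i j + \int[mu]_(s in `[0, v]) drift i j s.
Proof.
move=> v0 vS; have S0 : (0 < sigma0 beta)%E by rewrite (le_lt_trans _ vS)// lee_fin.
rewrite solution_at0// mxE.
have [->|im] := eqVneq i ord_max; last exact: solution_upper_entry.
by rewrite solution_last_entry// vS.
Qed.

Lemma solution_last_at_zero z j : zeros beta z -> gamma z ord_max j = 0.
Proof.
move=> Zz; have [z0 _] := Zz.
rewrite solution_last_entry// ltNge sigma0_le//=.
have -> : tau beta z = z by apply: tau_eq => // s; case: ltgtP.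
by rewrite set_itv1 Rintegral_set1.
Qed.

Lemma solution_at_zero z : zeros beta z -> gamma z = P *m gamma z.
Proof.
move=> Zz; apply/matrixP => i j; rewrite matP_mulE.
by have [->|] := eqVneq; rewrite ?mul1r// mul0r solution_last_at_zero.
Qed.

Lemma solution_after_zero z v i j : zeros beta z -> z <= v ->
  (forall s, z < s -> s <= v -> ~ zeros beta s) ->
  gamma v i j = gamma z i j + \int[mu]_(s in `[z, v]) drift i j s.
Proof.
move=> Zz zv nZ; have [z0 _] := Zz.
have [->|im] := eqVneq i ord_max; last exact: solution_upper_increment.
rewrite (solution_last_at_zero _ Zz) add0r solution_last_entry ?(le_trans z0)//.
rewrite ltNge (le_trans (sigma0_le Zz)) ?lee_fin//=.
by rewrite (tau_eq beta_cont Zz zv nZ).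
Qed.

Variable Ev : R -> R -> 'M[R]_d.+1.
Hypothesis alpha_cont : {within [set t : R | 0 <= t], continuous alpha}.
Hypothesis Ev_evolution : is_evolution alpha Ev.
Variable c : R.
Hypothesis alpha_le : forall t, 0 <= t -> forall i j, `|alpha t i j| <= c.

Lemma alpha_entry_continuous u i j : 0 < u ->
  {for u, continuous (fun s => alpha s i j)}.
Proof.
move=> u0; have au : {for u, continuous alpha}.
  move/subspace_continuousP : alpha_cont => /(_ u (ltW u0)).
  have un : nbhs u [set t : R | 0 <= t].
    by near=> s; apply: ltW; near: s; exact: lt_nbhsr.
  by rewrite within_interior.
exact: (cvg_comp _ _ au (@coord_continuous _ _ _ i j _)).
Unshelve. all: by end_near. Qed.

(** The endpoint b may be a zero, where gamma itself is reset; the left-hand side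
    is the left limit of gamma at b. *)
Lemma solution_flow a b : 0 <= a -> a <= b ->
  (forall s, a <= s -> s < b -> forall i j,
     gamma s i j = gamma a i j + \int[mu]_(r in `[a, s]) drift i j r) ->
  forall i j, gamma a i j + \int[mu]_(r in `[a, b]) drift i j r =
    (Ev a b *m gamma a) i j.
Proof.
move=> a0 ab ga i j.
(* y agrees with gamma on [a, b[ and, unlike gamma, is continuous at b. *)
pose y u := \matrix_(i, j) (gamma a i j + \int[mu]_(r in `[a, u]) drift i j r).
have ya : y a = gamma a.
  by apply/matrixP => k l; rewrite mxE set_itv1 Rintegral_set1 addr0.
have yg s : a <= s -> s < b -> y s = gamma s.
  by move=> sa sb; apply/matrixP => k l; rewrite mxE -ga.
have yE k l : (fun u => y u k l) =
    cst (gamma a k l) + (fun u => \int[mu]_(r in `[a, u]) drift k l r).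
  by apply/funext => u; rewrite mxE.
have yc k l : {within `[a, b], continuous (fun u => y u k l)}.
  rewrite yE => u; apply: cvgD; first exact: cvg_cst.
  apply: (@parameterized_integral_continuous _ a b (drift k l)) => //.
  exact: integrable_drift.
have -> : gamma a i j + \int[mu]_(r in `[a, b]) drift i j r = y b i j.
  by rewrite mxE.
rewrite -ya; congr (fun_of_matrix _ i j).
apply: (evolution_unique Ev_evolution alpha_le) => // u uab k l.
have /andP[au ub] : a < u < b by move: uab; rewrite in_itv.
have u0 : 0 < u by exact: le_lt_trans au.
have dc : {for u, continuous (drift k l)}.
  rewrite /prop_for /continuous_at /drift.
  have -> : (alpha u *m gamma u) k l = \sum_m alpha u k m * y u m l.
    by rewrite mxE; apply: eq_bigr => m _; rewrite yg// ltW.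
  have yu m : y s m l @[s --> u] --> y u m l.
    have ltab : a < b by exact: lt_trans ub.
    exact: (within_continuous_continuous ltab (yc m l) uab).
  have : (\sum_m alpha s k m * y s m l) @[s --> u] -->
      \sum_m alpha u k m * y u m l.
    apply: cvg_big => [|m _]; first exact: add_continuous.
    apply: cvgM; last exact: yu.
    exact: alpha_entry_continuous.
  apply: cvg_trans; apply: near_eq_cvg; near=> s => /=.
  have as_ : a < s by near: s; exact: lt_nbhsr.
  have sb : s < b by near: s; exact: lt_nbhsl.
  by rewrite mxE; apply: eq_bigr => m _; rewrite yg// ltW.
rewrite yE.
have [du dE] := continuous_FTC1 ub (integrable_drift k l a0 ab) au dc.
have dI : is_derive u 1 (fun u => \int[mu]_(r in `[a, u]) drift k l r)
    ((alpha u *m y u) k l).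
  by apply: DeriveDef => //; rewrite -derive1E dE /drift yg// ltW.
by apply: is_derive_eq; rewrite add0r.
Unshelve. all: by end_near. Qed.

(** No continuity of gamma is needed: each entry of gamma is at most 1 plus the
    integral of the corresponding |drift| over [0, T]. *)
Lemma drift_bounded T : 0 <= T ->
  exists2 C, 0 <= C & forall s i j, 0 <= s -> s <= T -> `|drift i j s| <= C.
Proof.
move=> T0.
have [K K0 KE] := exists_entry_bound
  (\matrix_(i, j) \int[mu]_(s in `[0, T]) `|drift i j s| : 'M[R]_d.+1).
have gK s i j : 0 <= s -> s <= T -> `|gamma s i j| <= 1 + K.
  move=> s0 sT.
  have intK u : 0 <= u -> u <= s -> `|\int[mu]_(r in `[u, s]) drift i j r| <= K.
    move=> u0 us.
    have di := integrable_drift i j (lexx 0) T0.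
    apply: le_trans (normr_Rintegral_subsegment_le u0 us sT di) _.
    by have := KE i j; rewrite mxE; apply: le_trans; exact: ler_norm.
  have delta1 : `|(i == j)%:R| <= 1 :> R.
    by case: (i == j); rewrite ?normr1// normr0.
  have iK : `|(i == j)%:R + \int[mu]_(r in `[0, s]) drift i j r| <= 1 + K.
    by rewrite (le_trans (ler_normD _ _))// lerD// intK.
  have [im|im] := eqVneq i ord_max; last by rewrite solution_upper_entry.
  rewrite im in intK iK *.
  rewrite solution_last_entry//; case: ltP => // Ss.
  have [Z0 S0] := sigma0_zero beta_cont Ss.
  have z0s : fine (sigma0 beta) <= s by rewrite -lee_fin -S0.
  have [[t0 _] ts _] := tau_zero beta_cont Z0 z0s.
  by rewrite (le_trans (intK _ t0 ts))// lerDr.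
have c0 : 0 <= c by rewrite (le_trans _ (@alpha_le 0 _ ord0 ord0)).
exists (d.+1%:R * (c * (1 + K))).
  by rewrite !mulr_ge0// addr_ge0.
move=> s i j s0 sT; apply: mulmx_entry_le => k l; first exact: alpha_le.
exact: gK.
Qed.

Local Notation F := (fun p : R * R => P *m Ev p.1 p.2 *m P).

(** The rows fixed by P are continuous, so the flow describes them up to and
    including b. *)
Lemma solution_flow_upper a b : 0 <= a -> a <= b ->
  (forall s, a <= s -> s < b -> forall i j,
     gamma s i j = gamma a i j + \int[mu]_(r in `[a, s]) drift i j r) ->
  P *m gamma b = P *m (Ev a b *m gamma a).
Proof.
move=> a0 ab ga; apply/matrixP => i j; rewrite !matP_mulE.
have [->|im] := eqVneq i ord_max; first by rewrite !mul0r.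
by rewrite -(solution_flow a0 ab ga) -solution_upper_increment.
Qed.

Lemma solution_at_sigma0 : (0 < sigma0 beta)%E -> sigma0 beta \is a fin_num ->
  P *m gamma (fine (sigma0 beta)) = P *m Ev 0 (fine (sigma0 beta)).
Proof.
move=> S0 Sfin; have z0 : 0 <= fine (sigma0 beta) by rewrite fine_ge0// ltW.
have := solution_flow_upper (lexx 0) z0.
rewrite {2}solution_at0// mulmx1; apply=> s s0 sS i j.
by apply: solution_before_sigma0 => //; rewrite -(fineK Sfin) lte_fin.
Qed.

Lemma solution_excursion p : excursion beta p ->
  P *m gamma p.2 = F p *m (P *m gamma p.1).
Proof.
move=> ep; have [p12 _ _] := ep; have [Zp1 _ nZ] := excursion_zeros ep.
have [p0 _] := Zp1.
rewrite (solution_flow_upper p0 (ltW p12)) => [|s ps sp i j]; last first.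
  apply: solution_after_zero => // r pr rs; apply: nZ.
  by rewrite in_itv/= pr (le_lt_trans rs).
by rewrite -!mulmxA (mulmxA P P) matPP -(solution_at_zero Zp1).
Qed.

Lemma sumsq_excursion_factor_le p (X : 'M[R]_d.+1) : excursion beta p ->
  sumsq (F p *m X) <= expR (2 * c * d.+1%:R * (p.2 - p.1)) * sumsq X.
Proof.
move=> ep; have [p12 _ _] := ep; have [[p0 _] _ _] := excursion_zeros ep.
rewrite -!mulmxA (le_trans (sumsq_matP_le _))//.
rewrite (le_trans (sumsq_evolution_mul Ev_evolution alpha_le _ p0 (ltW p12)))//.
by rewrite ler_wpM2l ?expR_ge0// sumsq_matP_le.
Qed.

Hypothesis zeros_null : mu (zeros beta) = 0%E.

(** Applied to P gamma at sigma0, the finite products converge to P gamma at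
    tau t: the error is at most a constant times the length that the excursions
    of L leave uncovered. *)
Lemma finite_product_approx t e : (sigma0 beta <= t%:E)%E -> 0 < e ->
  exists2 L0 : {fset R * R}, [set` L0] `<=` excursions_in beta t &
    forall L : {fset R * R}, [set` L0] `<=` [set` L] ->
      [set` L] `<=` excursions_in beta t -> forall i j,
      `|(P *m gamma (tau beta t) - fin_ordered_prod (@itv_le R) F L *m
         (P *m gamma (fine (sigma0 beta)))) i j| <= e.
Proof.
move=> St e0; have [Z0 S0] := sigma0_zero beta_cont St.
set z0 := fine (sigma0 beta) in Z0 S0 *.
have z0t : z0 <= t by rewrite -lee_fin -S0.
have [Zz zt zmax] := tau_zero beta_cont Z0 z0t.
set z := tau beta t in Zz zt zmax *.
have z0z : z0 <= z by exact: zmax.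
have z00 : 0 <= z0 by case: Z0.
have c0 : 0 <= c by rewrite (le_trans _ (@alpha_le 0 _ ord0 ord0)).
have [C C0 driftC] := drift_bounded (le_trans z00 z0z).
pose M := 2 * c * d.+1%:R; have M0 : 0 <= M by rewrite !mulr_ge0.
pose B := d.+1%:R * expR (M * z); have B0 : 0 <= B by rewrite mulr_ge0 ?expR_ge0.
have BC : 0 < B * C + 1 by rewrite ltr_wpDl// mulr_ge0.
have [L0 L0K L0cov] :=
  finite_excursions_almost_cover beta_cont zeros_null Zz (divr_gt0 e0 BC).
have L0t : [set` L0] `<=` excursions_in beta t.
  move=> p /L0K[ep pz]; split=> // s /=; rewrite !in_itv/= => /andP[ps sp].
  have [[p0 _] _ _] := excursion_zeros ep.
  by rewrite (le_trans p0 (ltW ps)) (le_trans (ltW sp))// (le_trans pz).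
exists L0 => // L L0L LK i j.
have LE p : p \in L -> excursion beta p by move=> /LK[].
have L12 p : p \in L -> p.1 < p.2 by move=> /LE[].
have Lz p : p \in L -> [/\ z0 <= p.1, p.1 < p.2 & p.2 <= z].
  move=> pL; have [_ pt] := LK p pL; have [p12 Sp _] := LE p pL.
  have [_ Z2 _] := excursion_zeros (LE p pL).
  split=> //; first by rewrite -lee_fin -S0.
  apply: zmax => //; rewrite leNgt; apply/negP => tp.
  (* Otherwise some point of the excursion lies to the right of t. *)
  pose m := (Num.max t p.1 + p.2) / 2.
  have mm : Num.max t p.1 < p.2 by rewrite gt_max tp.
  have [mt mp] : t <= Num.max t p.1 /\ p.1 <= Num.max t p.1.
    by rewrite !le_max !lexx orbT.
  have /pt : m \in `]p.1, p.2[ by rewrite in_itv/= /m; apply/andP; split; lra.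
  by rewrite /= in_itv/= => /andP[_]; rewrite /m; lra.
set s := sort (@itv_le R) (enum_fset L).
have sL p : (p \in s) = (p \in L) by rewrite mem_sort.
have [S1 bnd] : \sum_(q <- s) (q.2 - q.1) <= z - z0 /\ forall i j,
    `|(P *m gamma z - (\prod_(k <- rev s) F k) *m (P *m gamma z0)) i j| <=
    d.+1%:R * expR (M * z) * (C * (z - z0 - \sum_(q <- s) (q.2 - q.1))).
  apply: (telescoping_bound M0 (x := fun u => P *m gamma u)) => //.
  - by move=> q; rewrite sL => qL X; apply: sumsq_excursion_factor_le; exact: LE.
  - by move=> q; rewrite sL => /LE; exact: solution_excursion.
  - move=> u v k l u0 uv vz; rewrite -mulmxBr matP_mulE.
    have [->|km] := eqVneq k ord_max.
      by rewrite mul0r normr0 mulr_ge0// subr_ge0.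
    rewrite mul1r !mxE (solution_upper_increment _ u0 uv km) addrAC subrr add0r.
    apply: normr_Rintegral_segment_le => //; first exact: integrable_drift.
    move=> r; rewrite in_itv/= => /andP[ur rv]; apply: driftC.
      exact: le_trans ur.
    exact: le_trans vz.
  - by move=> q; rewrite sL; exact: Lz.
  - apply: sort_itv_le_pairwise => // p q /LE ep /LE exq.
    exact: (excursions_separated ep exq).
apply: (le_trans (bnd i j)).
have cov : z - z0 - \sum_(q <- s) (q.2 - q.1) <= e / (B * C + 1).
  rewrite lerBlDr; apply: L0cov => p; first by rewrite sL; exact: L12.
  by rewrite sL => pL0; exact: L0L.
rewrite -/B mulrA (le_trans (ler_wpM2l _ cov)) ?mulr_ge0//.
by rewrite mulrA ler_pdivrMr// mulrC ler_pM2l// lerDl.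
Qed.

End Solution.

(** * The product formula *)

Lemma mx_norm_entry_bound (R : realType) (m n : nat) (T : Type) (A : set T)
    (f : T -> 'M[R]_(m.+1, n.+1)) : [bounded f t | t in A] ->
  exists c : R, forall t, A t -> forall i j, `|f t i j| <= c.
Proof.
move=> [M [_ fM]]; exists (M + 1) => t At i j.
have := fM (M + 1) _ t At; rewrite ltrDl ltr01 => /(_ isT); apply: le_trans.
rewrite [leRHS]/Num.Def.normr/= mx_normrE.
exact: (le_bigmax _ (fun i => `|f t i.1 i.2|) (i, j)).
Qed.

Theorem theorem4 (R : realType) (d : nat)
    (alpha : R -> 'M[R]_d.+1) (beta : R -> R)
    (gamma : R -> 'M[R]_d.+1) (Ev : R -> R -> 'M[R]_d.+1)
    (alpha_cont : {within [set t : R | 0 <= t], continuous alpha})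
    (alpha_bounded : [bounded alpha t | t in [set t : R | 0 <= t]])
    (beta_cont : {within [set t : R | 0 <= t], continuous beta})
    (beta0 : beta 0 != 0)
    (zeros_null : @lebesgue_measure R (zeros beta) = 0%E)
    (Ev_evolution : is_evolution alpha Ev)
    (gamma_solution : is_solution alpha beta gamma)
    (t : R) (t_ge0 : 0 <= t) :
  ((t%:E < sigma0 beta)%E -> gamma t = Ev 0 t) /\
  ((sigma0 beta <= t%:E)%E ->
    exists2 U : 'M[R]_d.+1,
      ordered_prod_cvg (@itv_le R) (excursions_in beta t)
        (fun p => matP R d *m Ev p.1 p.2 *m matP R d) U
    & gamma t =
        Ev (tau beta t) t *m matP R d *m U *m Ev 0 (fine (sigma0 beta))).
Proof.
have [c alpha_le] := mx_norm_entry_bound alpha_bounded.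
set P := matP R d; set F := fun p : R * R => P *m Ev p.1 p.2 *m P.
split=> [tS|St].
  have S0 : (0 < sigma0 beta)%E by rewrite (le_lt_trans _ tS)// lee_fin.
  apply/matrixP => i j.
  rewrite -[Ev 0 t]mulmx1 -(solution_at0 gamma_solution S0).
  rewrite -(solution_flow gamma_solution alpha_cont Ev_evolution alpha_le) //.
    exact: (solution_before_sigma0 gamma_solution).
  move=> s s0 st k l; apply: (solution_before_sigma0 gamma_solution) => //.
  by rewrite (lt_trans _ tS)// lte_fin.
have [Z0 S0E] := sigma0_zero beta_cont St.
set z0 := fine (sigma0 beta) in Z0 S0E *.
have z0t : z0 <= t by rewrite -lee_fin -S0E.
have [Zz zt zmax] := tau_zero beta_cont Z0 z0t.
set z := tau beta t in Zz zt zmax *.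
have z00 : 0 <= z0 by case: Z0.
have z0z : 0 <= z by case: Zz.
have S0 : (0 < sigma0 beta)%E.
  rewrite S0E lte_fin lt_neqAle z00 andbT; apply: contra beta0 => /eqP z0E.
  by case: Z0 => _; rewrite -z0E => ->.
have xz0 : P *m gamma z0 = P *m Ev 0 z0.
  have Sfin : sigma0 beta \is a fin_num by rewrite S0E.
  exact: (solution_at_sigma0 gamma_solution alpha_cont Ev_evolution alpha_le).
have gammaE : gamma t = Ev z t *m (P *m gamma z).
  rewrite -(solution_at_zero beta_cont gamma_solution Zz).
  have after s : z <= s -> s <= t -> forall i j, gamma s i j = gamma z i j +
      \int[@lebesgue_measure R]_(r in `[z, s]) drift alpha gamma i j r.
    move=> zs st i j.
    apply: (solution_after_zero beta_cont gamma_solution) => // r zr rs Zr.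
    by have := zmax r Zr (le_trans rs st); rewrite leNgt zr.
  apply/matrixP => i j.
  rewrite -(solution_flow gamma_solution alpha_cont Ev_evolution alpha_le) //.
    exact: after.
  by move=> s zs st k l; apply: after => //; exact: ltW.
have approx := finite_product_approx beta_cont gamma_solution alpha_cont
  Ev_evolution alpha_le zeros_null St.
rewrite -/z -/z0 -/P -/F in approx.
have [K0|[p0 Kp0]] : excursions_in beta t = set0 \/ excursions_in beta t !=set0.
  by have [->|/set0P] := eqVneq (excursions_in beta t) set0; [left|right].
(* Without excursions the only product is empty, and P gamma takes the same value
   at sigma0 and at tau t. *)
- have Kempty (L : {fset R * R}) :
      [set` L] `<=` excursions_in beta t -> L = fset0.
    by rewrite K0 => L0; apply/fsetP => p; rewrite inE; apply/negP => /L0.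
  have prod0 : fin_ordered_prod (@itv_le R) F fset0 = 1%:M.
    rewrite /fin_ordered_prod.
    have -> : sort (@itv_le R) (enum_fset fset0) = [::] by [].
    by rewrite big_nil.
  exists 1%:M.
    move=> e e0; exists fset0 => [p //|L _ /Kempty ->].
    rewrite prod0 subrr (le_lt_trans (@op_norm_le _ _ _ 0 _ _))//.
      by move=> i j; rewrite mxE normr0.
    by rewrite mulr0.
  rewrite mulmx1 -mulmxA -xz0 gammaE; congr (_ *m _).
  apply/eqP; rewrite -subr_eq0; apply/eqP/matrixP => i j; rewrite [RHS]mxE.
  apply/eqP; rewrite -normr_le0; apply/ler_addgt0Pl => e e0; rewrite addr0.
  have [L0 L0K /(_ L0 _ L0K i j)] := approx e e0.
  by rewrite (Kempty _ L0K) prod0 mul1mx; apply.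
have Eu : Ev 0 z0 \in unitmx by exact: (evolution_unitmx Ev_evolution alpha_le).
set V := invmx (Ev 0 z0).
exists (P *m gamma z *m V); last first.
  by rewrite gammaE -!mulmxA mulVmx// mulmx1 [in RHS](mulmxA P P) matPP.
move=> e e0.
have [k k0 Vk] := exists_entry_bound V.
(* The constant of [op_norm_le] times that of one matrix product. *)
pose n3 : R := d.+1%:R ^+ 3 * k.
have n30 : 0 <= n3 by rewrite mulr_ge0// exprn_ge0.
have n31 : 0 < n3 + 1 by rewrite ltr_wpDl.
have [L0 L0K L0a] := approx _ (divr_gt0 e0 n31).
(* Adding p0 makes every admissible L nonempty. *)
exists (p0 |` L0)%fset.
  by move=> p; rewrite /= !inE => /predU1P[->//|]; exact: L0K.
move=> L L0L LK.
have p0L : p0 \in L by apply: L0L; rewrite /= !inE eqxx.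
(* A nonempty product ends with a factor P on the right, so it is determined by
   its action on P *m Ev 0 sigma0, as Ev 0 sigma0 is invertible. *)
have PiP : fin_ordered_prod (@itv_le R) F L *m P =
    fin_ordered_prod (@itv_le R) F L.
  rewrite /fin_ordered_prod.
  have : p0 \in sort (@itv_le R) (enum_fset L) by rewrite mem_sort.
  case: (sort _ _) => // q s _.
  rewrite prod_rev_cons_mul -[RHS]mulmx1 prod_rev_cons_mul mulmx1.
  by rewrite /F -!mulmxA matPP.
have -> : fin_ordered_prod (@itv_le R) F L - P *m gamma z *m V =
    - (P *m gamma z - fin_ordered_prod (@itv_le R) F L *m (P *m gamma z0)) *m V.
  rewrite opprB mulmxBl xz0; congr (_ - _).
  by rewrite (mulmxA _ P) PiP -mulmxA mulmxV// mulmx1.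
set D := P *m gamma z - _.
have De i j : `|D i j| <= e / (n3 + 1).
  by apply: L0a => // p pL0; apply: L0L; rewrite /= !inE pL0 orbT.
have NDV i j : `|(- D *m V) i j| <= d.+1%:R * (e / (n3 + 1) * k).
  by apply: mulmx_entry_le => // k' l; rewrite mxE normrN.
have e1 : 0 <= e / (n3 + 1) by rewrite divr_ge0// ltW.
have b0 : 0 <= d.+1%:R * (e / (n3 + 1) * k) by rewrite mulr_ge0// mulr_ge0.
rewrite (le_lt_trans (op_norm_le b0 NDV))//.
have -> : d.+1%:R ^+ 2 * (d.+1%:R * (e / (n3 + 1) * k)) = e * (n3 / (n3 + 1)).
  by set w := (n3 + 1)^-1; rewrite /n3; ring.
by rewrite gtr_pMr// ltr_pdivrMr// mul1r ltrDl.
Qed.
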